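(* Let $R$ be a ring that is a finite-dimensional algebra over each of two fields $k_1$ and $k_2$, and suppose that $R$ is a Frobenius $k_1$-algebra (equivalently, a Frobenius $k_2$-algebra). Then $\mathrm{Hom}_{k_1}(R,k_1) \simeq \mathrm{Hom}_{k_2}(R,k_2)$ as $(R,R)$-bimodules. That is, the bimodule isomorphism type of the $k$-dual of a Frobenius $k$-algebra $R$ is independent of $k$.
   Context: Rings are associative with identity. A ring $R$ is an algebra over a field $k$ via a unital ring homomorphism $k \to Z(R)$ into the center of $R$; no relation between $k_1$ and $k_2$ is assumed. For a finite-dimensional $k$-algebra $R$, the $k$-dual $\hat R = \mathrm{Hom}_k(R,k)$ is an $(R,R)$-bimodule via $(rf)(s) = f(sr)$ and $(fr)(s) = f(rs)$, and $R$ is a Frobenius $k$-algebra if $R \simeq \hat R$ as left $R$-modules; equivalently, there is a $k$-linear functional $R \to k$ whose kernel contains no nonzero left ideal. It is known that this is equivalent to $R$ being isomorphic as a left $R$-module to the injective hull of $R/\mathrm{rad}\,R$ (with $\mathrm{rad}\,R$ the Jacobson radical), so being a Frobenius $k$-algebra does not depend on $k$. *)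

(* Defs.v *)
From HB Require Import structures.
From mathcomp Require Import all_boot all_order all_algebra.
From mathcomp Require Import boolp.
Set Implicit Arguments.
Unset Strict Implicit.
Unset Printing Implicit Defensive.
Import GRing.Theory.
Local Open Scope ring_scope.

(* The left [R]-module structure is the scaling [r *: v]; the mixin adds the
   right action of [S], written [rscale v s]. *)
HB.mixin Record Lmodule_isBimodule (R S : pzRingType) V
    of GRing.Lmodule R V := {
  rscale : V -> S -> V;
  rscalerA : forall v s t, rscale (rscale v s) t = rscale v (s * t);
  rscaler1 : forall v, rscale v 1 = v;
  rscalerDl : forall s, {morph rscale^~ s : u v / u + v};
  rscalerDr : forall v, {morph rscale v : s t / s + t};
  rscaleAC : forall r v s, rscale (r *: v) s = r *: rscale v s
}.

#[short(type="bimodType")]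
HB.structure Definition Bimodule (R S : pzRingType) :=
  {V of Lmodule_isBimodule R S V & GRing.Lmodule R V}.

Definition lmod_iso (R : pzRingType) (U V : lmodType R) : Prop :=
  exists f : {linear U -> V}, bijective f.

Definition bimod_iso (R S : pzRingType) (U V : bimodType R S) : Prop :=
  exists f : {linear U -> V},
    bijective f /\ forall (u : U) (s : S), f (rscale u s) = rscale (f u) s.

(* The library's [algType k] fixes a single scalar field for each carrier and
   excludes the zero ring, so a [k]-algebra structure on a given ring [R] is
   represented by its structure map from [k] to the center of [R]. *)
Record algebra (k : fieldType) (R : pzRingType) := Algebra {
  alg_map :> {rmorphism k -> R};
  alg_central : forall (a : k) (x : R), GRing.comm (alg_map a) x
}.

Definition underlying (k : fieldType) (R : pzRingType) (A : algebra k R) :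
  Type := R.

Section Underlying.
Variables (k : fieldType) (R : pzRingType) (A : algebra k R).

HB.instance Definition _ := GRing.Zmodule.on (underlying A).

Let scale (a : k) (x : underlying A) : underlying A := A a * (x : R).

Fact underlying_scaleA a b x : scale a (scale b x) = scale (a * b) x.
Proof. by rewrite /scale rmorphM mulrA. Qed.
Fact underlying_scale1 : left_id 1 scale.
Proof. by move=> x; rewrite /scale rmorph1 mul1r. Qed.
Fact underlying_scaleDr : right_distributive scale +%R.
Proof. by move=> a x y; apply: mulrDr. Qed.
Fact underlying_scaleDl x : {morph scale^~ x : a b / a + b}.
Proof. by move=> a b; rewrite /scale rmorphD mulrDl. Qed.

HB.instance Definition _ := GRing.Zmodule_isLmodule.Build k (underlying A)
  underlying_scaleA underlying_scale1 underlying_scaleDr underlying_scaleDl.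

Definition finite_dimensional : Prop :=
  exists n : nat, inhabited (Vector.axiom n (underlying A)).

Definition dual : Type := {scalar underlying A}.

Definition dual_fun (f : dual) : R -> k := f : {scalar underlying A}.

Lemma dual_ext (f g : dual) : dual_fun f =1 dual_fun g -> f = g.
Proof.
case: f g => [f [[fa] [fs]]] [g [[ga] [gs]]] /= /funext eq_fg.
rewrite /dual_fun /= in eq_fg; subst g.
by rewrite (Prop_irrelevance fa ga) (Prop_irrelevance fs gs).
Qed.

Lemma dual_funD (f : dual) x y : dual_fun f (x + y) = dual_fun f x + dual_fun f y.
Proof. exact: (raddfD (f : {scalar underlying A})). Qed.

Lemma dual_funZ (f : dual) a x : dual_fun f (A a * x) = a * dual_fun f x.
Proof. exact: (linearZ_LR (f : {scalar underlying A}) a x). Qed.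

Section MkDual.
Variables (g : R -> k) (gD : {morph g : x y / x + y}).
Hypothesis gZ : forall a x, g (A a * x) = a * g x.

Fact mk_dual_scalar : scalar (g : underlying A -> k).
Proof. by move=> a x y; rewrite gD gZ. Qed.

Definition mk_dual : dual :=
  HB.pack_for {scalar underlying A} (g : underlying A -> k)
    (GRing.isLinear.Build k (underlying A) k *%R
       (g : underlying A -> k) mk_dual_scalar).

Lemma mk_dualE x : dual_fun mk_dual x = g x. Proof. by []. Qed.
End MkDual.

HB.instance Definition _ := gen_eqMixin dual.
HB.instance Definition _ := gen_choiceMixin dual.

Definition dual_zero : dual.
Proof.
apply: (@mk_dual (fun=> 0)) => [x y|a x]; first by rewrite addr0.
by rewrite mulr0.
Defined.

Definition dual_opp (f : dual) : dual.
Proof.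
apply: (@mk_dual (fun x => - dual_fun f x)) => [x y|a x].
  by rewrite dual_funD opprD.
by rewrite dual_funZ mulrN.
Defined.

Definition dual_add (f g : dual) : dual.
Proof.
apply: (@mk_dual (fun x => dual_fun f x + dual_fun g x)) => [x y|a x].
  by rewrite !dual_funD addrACA.
by rewrite !dual_funZ mulrDr.
Defined.

Definition dual_lscale (r : R) (f : dual) : dual.
Proof.
apply: (@mk_dual (fun s => dual_fun f (s * r))) => [x y|a x].
  by rewrite mulrDl dual_funD.
by rewrite -mulrA dual_funZ.
Defined.

Definition dual_rscale (f : dual) (r : R) : dual.
Proof.
apply: (@mk_dual (fun s => dual_fun f (r * s))) => [x y|a x].
  by rewrite mulrDr dual_funD.
by rewrite mulrA -(alg_central A a r) -mulrA dual_funZ.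
Defined.

Fact dual_addA : associative dual_add.
Proof. by move=> f g h; apply: dual_ext => x; apply: addrA. Qed.
Fact dual_addC : commutative dual_add.
Proof. by move=> f g; apply: dual_ext => x; apply: addrC. Qed.
Fact dual_add0 : left_id dual_zero dual_add.
Proof. by move=> f; apply: dual_ext => x; apply: add0r. Qed.
Fact dual_addN : left_inverse dual_zero dual_opp dual_add.
Proof. by move=> f; apply: dual_ext => x; apply: addNr. Qed.

HB.instance Definition _ := GRing.isZmodule.Build dual
  dual_addA dual_addC dual_add0 dual_addN.

Fact dual_lscaleA r s f : dual_lscale r (dual_lscale s f) = dual_lscale (r * s) f.
Proof. by apply: dual_ext => x; rewrite !mk_dualE mulrA. Qed.
Fact dual_lscale1 : left_id 1 dual_lscale.
Proof. by move=> f; apply: dual_ext => x; rewrite mk_dualE mulr1. Qed.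
Fact dual_lscaleDr : right_distributive dual_lscale +%R.
Proof. by move=> r f g; apply: dual_ext. Qed.
Fact dual_lscaleDl f : {morph dual_lscale^~ f : r s / r + s}.
Proof. by move=> r s; apply: dual_ext => x; rewrite mk_dualE mulrDr dual_funD. Qed.

HB.instance Definition _ := GRing.Zmodule_isLmodule.Build R dual
  dual_lscaleA dual_lscale1 dual_lscaleDr dual_lscaleDl.

Fact dual_rscaleA f r s : dual_rscale (dual_rscale f r) s = dual_rscale f (r * s).
Proof. by apply: dual_ext => x; rewrite !mk_dualE mulrA. Qed.
Fact dual_rscale1 f : dual_rscale f 1 = f.
Proof. by apply: dual_ext => x; rewrite mk_dualE mul1r. Qed.
Fact dual_rscaleDl r : {morph dual_rscale^~ r : f g / f + g}.
Proof. by move=> f g; apply: dual_ext. Qed.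
Fact dual_rscaleDr f : {morph dual_rscale f : r s / r + s}.
Proof. by move=> r s; apply: dual_ext => x; rewrite mk_dualE mulrDl dual_funD. Qed.
Fact dual_rscaleAC r f s : dual_rscale (r *: f) s = r *: dual_rscale f s.
Proof. by apply: dual_ext => x; rewrite !mk_dualE mulrA. Qed.

HB.instance Definition _ := Lmodule_isBimodule.Build R R dual
  dual_rscaleA dual_rscale1 dual_rscaleDl dual_rscaleDr dual_rscaleAC.

Definition frobenius : Prop := lmod_iso R^o dual.

Lemma dual_lscaleE (r : R) (f : dual) (s : R) :
  dual_fun (r *: f) s = dual_fun f (s * r).
Proof. by []. Qed.

Lemma dual_rscaleE (f : dual) (r s : R) :
  dual_fun (rscale f r) s = dual_fun f (r * s).
Proof. by []. Qed.

End Underlying.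

(* Main.v *)
(* Let C be the center of R.  Since k_i lies in C, tensor-hom adjunction gives
   Hom_{k_i}(R, k_i) = Hom_C(R, E_i) with E_i = Hom_{k_i}(C, k_i), as
   bimodules, so it suffices that E_1 and E_2 are isomorphic C-modules.  A
   C-linear map E_1 -> E_2 amounts to a k_2-linear functional on E_1, and it is
   injective when the kernel of the functional contains no nonzero submodule.
   Such a functional is assembled over primitive idempotents e of C: eE_1 has a
   simple essential socle, so it is enough not to vanish on that socle.  By
   symmetry there is an embedding E_2 -> E_1 as well, and the composite
   E_1 -> E_1 is bijective because E_1 is finite-dimensional over k_1. *)
From HB Require Import structures.
Require Import Defs.
From mathcomp Require Import all_boot all_algebra.
From mathcomp Require Import boolp ring.
Set Implicit Arguments.
Unset Strict Implicit.
Unset Printing Implicit Defensive.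
Import GRing.Theory.
Local Open Scope ring_scope.

(** * Bijections and subspaces of row vectors *)

Lemma inj_surj_bijective (T U : Type) (f : T -> U) :
  injective f -> (forall y, exists x, f x = y) -> bijective f.
Proof.
move=> f_inj /choice[g gK]; exists g => // x; apply: f_inj; exact: gK.
Qed.

(** Among the matrices whose row space lies in [W], take one of maximal rank: adjoining a [u] from
    [W] cannot raise the rank, so [u] is already in its row space. *)
Lemma subspace_submx (k : fieldType) n (W : 'rV[k]_n -> Prop) :
  W 0 -> (forall a u v, W u -> W v -> W (a *: u + v)) ->
  exists M : 'M[k]_n, forall u, W u <-> (u <= M)%MS.
Proof.
move=> W0 WL.
pose P r := `[< exists2 M : 'M[k]_n, \rank M = r &
                 forall u : 'rV_n, (u <= M)%MS -> W u >].
have exP : exists r, P r.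
  exists 0; apply/asboolP; exists 0; first exact: mxrank0.
  by move=> u; rewrite submx0 => /eqP->.
have ubP r : P r -> (r <= n)%N by move=> /asboolP[M <- _]; apply: rank_leq_row.
case: (ex_maxnP exP ubP) => r /asboolP[M rM WM] max_r.
exists M => u; split=> [Wu|]; last exact: WM.
have /max_r : P (\rank (M + u)%MS).
  apply/asboolP; exists (M + u)%MS => // w /sub_addsmxP[[w1 w2] /= ->].
  rewrite addrC; have [a ->] : exists a, w2 *m u = a *: u.
    by exists (w2 0 0); rewrite -mul_scalar_mx -mx11_scalar.
  by apply: WL => //; apply/WM/submxMl.
rewrite -rM => le_rank; apply: submx_trans (addsmxSr M u) _.
have [+ eq_rank] := mxrank_leqif_sup (addsmxSl M u).
by rewrite -eq_rank eqn_leq => ->.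
Qed.

(** * Dual bases of a finite-dimensional algebra *)

Section Algebra.
Variables (k : fieldType) (R : pzRingType) (A : algebra k R).

(** A basis of the image of [g] supplies the coordinates. This later passes finite dimension from a
    ring to its center. *)
Lemma finite_dimensional_inj n (g : {linear underlying A -> 'rV[k]_n}) :
  injective g -> finite_dimensional A.
Proof.
move=> g_inj.
have [||M MP] := @subspace_submx k n (fun u => exists x, u = g x).
- by exists 0; rewrite linear0.
- by move=> a _ _ [x ->] [y ->]; exists (a *: x + y); rewrite linearP.
set B := row_base M.
have gB x : (g x <= B)%MS by rewrite eq_row_base; apply/MP; exists x.
exists (\rank M); split; exists (fun x => g x *m pinvmx B).
  by move=> a x y; rewrite linearP mulmxDl scalemxAl.
apply: inj_surj_bijective => [x y eq_xy|w].
  by apply: g_inj; rewrite -(mulmxKpV (gB x)) -(mulmxKpV (gB y)) eq_xy.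
have [x gx] : exists x, w *m B = g x.
  by apply/MP; rewrite -(eq_row_base M) submxMl.
by exists x; rewrite -gx mulmxKp // row_base_free.
Qed.

Lemma dual_fun_sum I (r : seq I) (P : pred I) (f : dual A) (F : I -> R) :
  dual_fun f (\sum_(i <- r | P i) F i) = \sum_(i <- r | P i) dual_fun f (F i).
Proof. exact: (raddf_sum (f : {scalar underlying A})). Qed.

Lemma dual_addE (f g : dual A) x :
  dual_fun (f + g) x = dual_fun f x + dual_fun g x.
Proof. by []. Qed.

Lemma dual_funE_sum I (r : seq I) (P : pred I) (F : I -> dual A) x :
  dual_fun (\sum_(i <- r | P i) F i) x = \sum_(i <- r | P i) dual_fun (F i) x.
Proof. by apply: (big_morph (fun f => dual_fun f x)). Qed.

Definition dual_basis n (b : 'I_n -> R) (v : 'I_n -> dual A) : Prop :=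
  (forall x, x = \sum_i A (dual_fun (v i) x) * b i) /\
  (forall i j, dual_fun (v i) (b j) = (i == j)%:R).

Lemma dual_basis_exists : finite_dimensional A ->
  exists n (b : 'I_n -> R) (v : 'I_n -> dual A), dual_basis b v.
Proof.
case=> n [[v v_lin [r vK rK]]].
have vZ a x : v (A a * x) = a *: v x.
  have v0 : v 0 = 0 by have := v_lin (-1) 0 0; rewrite !scaleN1r !addNr.
  by have := v_lin a x 0; rewrite v0 !addr0.
have vD x y : v (x + y) = v x + v y.
  by have := v_lin 1 x y; rewrite !scale1r.
have wD i : {morph (fun x => v x 0 i) : x y / x + y}.
  by move=> x y /=; rewrite vD mxE.
have wZ i a x : v (A a * x) 0 i = a * v x 0 i by rewrite vZ mxE.
exists n, (fun i => r (delta_mx 0 i)), (fun i => mk_dual (wD i) (wZ i)).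
split=> [x|i j]; last by rewrite mk_dualE rK mxE eqxx.
apply: (can_inj vK); rewrite (big_morph v vD (id1 := 0)).
  by rewrite {1}[v x]row_sum_delta; apply: eq_bigr => i _; rewrite vZ rK.
by have := vZ 0 0; rewrite mulr0 scale0r.
Qed.

Section DualBasis.
Variables (n : nat) (b : 'I_n -> R) (v : 'I_n -> dual A).
Hypothesis bv : dual_basis b v.

Lemma dual_fun_basisE (f : dual A) x :
  dual_fun f x = \sum_i dual_fun (v i) x * dual_fun f (b i).
Proof.
rewrite {1}(bv.1 x) dual_fun_sum; apply: eq_bigr => i _; exact: dual_funZ.
Qed.

Lemma dual_basis_ext (f g : dual A) :
  (forall i, dual_fun f (b i) = dual_fun g (b i)) -> f = g.
Proof.
move=> eq_fg; apply: dual_ext => x; rewrite (dual_fun_basisE f).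
by rewrite (dual_fun_basisE g); apply: eq_bigr => i _; rewrite eq_fg.
Qed.

Lemma dual_basis_inj (x y : R) :
  (forall i, dual_fun (v i) x = dual_fun (v i) y) -> x = y.
Proof.
move=> eq_xy; rewrite (bv.1 x) (bv.1 y).
by apply: eq_bigr => i _; rewrite eq_xy.
Qed.

(** Scalars act through the central elements [A a], so the coordinate forms [v] also generate the
    dual as an [R]-module. *)
Lemma dual_basis_expand (f : dual A) :
  f = \sum_i A (dual_fun f (b i)) *: v i.
Proof.
apply: dual_basis_ext => j; rewrite dual_funE_sum (bigD1 j) //= big1 ?addr0.
  by rewrite -(alg_central A _ (b j)) dual_funZ bv.2 eqxx mulr1.
move=> i ne_ij; rewrite -(alg_central A _ (b j)) dual_funZ bv.2.
by rewrite (negPf ne_ij) mulr0.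
Qed.

End DualBasis.
End Algebra.

(** * Minimal cyclic submodules over a commutative algebra *)

Lemma exists_minimal (T : Type) (d : T -> nat) (P : T -> Prop) :
  (exists x, P x) -> exists2 x, P x & forall y, P y -> (d x <= d y)%N.
Proof.
case=> x0 Px0; pose Q m := `[< exists2 x, P x & d x = m >].
have exQ : exists m, Q m by exists (d x0); apply/asboolP; exists x0.
case: (ex_minnP exQ) => m /asboolP[x Px <-] min_m.
by exists x => // y Py; apply: min_m; apply/asboolP; exists y.
Qed.

Section CommutativeAlgebra.
Variables (k : fieldType) (C : comPzRingType) (A : algebra k C).

(** The rows of [G u] span the image of [C u], so its rank is the dimension of [C u]; [u] minimizes
    it. If [P (c *: u)], then [C c u] lies in [C u] without being smaller, hence contains [u]. *)
Lemma cyclic_minimal (V : lmodType C) n (phi : V -> 'rV[k]_n) (P : V -> Prop) :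
    finite_dimensional A -> injective phi -> {morph phi : u w / u + w} ->
    (forall a u, phi (A a *: u) = a *: phi u) -> (exists u, P u) ->
  exists2 u, P u & forall c, P (c *: u) -> exists d, u = d *: (c *: u).
Proof.
move=> /dual_basis_exists[m [b [v bv]]] phi_inj phiD phiZ exP.
pose G u := \matrix_i phi (b i *: u).
have phi0 : phi 0 = 0 by have := phiZ 0 0; rewrite rmorph0 !scale0r.
have phiG c u : phi (c *: u) = \row_i dual_fun (v i) c *m G u.
  rewrite {1}(bv.1 c) scaler_suml (big_morph phi phiD phi0) mulmx_sum_row.
  by apply: eq_bigr => i _; rewrite -scalerA phiZ mxE rowK.
have [u Pu min_u] := exists_minimal (fun u => \rank (G u)) exP.
exists u => // c /min_u le_rank.
have leG : (G (c *: u) <= G u)%MS.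
  by apply/row_subP => i; rewrite rowK scalerA phiG submxMl.
have [_ eq_rank] := mxrank_leqif_sup leG.
have /(submx_trans _) sG : (G u <= G (c *: u))%MS.
  by rewrite -eq_rank eqn_leq le_rank mxrankS.
have /submxP[D phiu] : (phi u <= G (c *: u))%MS.
  by apply: sG; rewrite -[u in phi u]scale1r phiG submxMl.
(* [D] is the coordinate row of the multiplier sought. *)
exists (\sum_i A (D 0 i) * b i); apply: phi_inj; rewrite phiu phiG.
congr (_ *m _); apply/rowP => j; rewrite mxE dual_fun_sum (bigD1 j) //=.
rewrite dual_funZ bv.2 eqxx mulr1 big1 ?addr0 // => i ne_ij.
by rewrite dual_funZ bv.2 eq_sym (negPf ne_ij) mulr0.
Qed.

Hypothesis A_fd : finite_dimensional A.

Lemma ring_cyclic_minimal (P : C -> Prop) : (exists x, P x) ->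
  exists2 x, P x & forall c, P (c * x) -> exists d, x = d * (c * x).
Proof.
have [n [b [v bv]]] := dual_basis_exists A_fd.
apply: (@cyclic_minimal C^o n (fun x => \row_i dual_fun (v i) x)) => //.
- move=> x y /rowP eq_xy; apply: (dual_basis_inj bv) => i.
  by have := eq_xy i; rewrite !mxE.
- by move=> x y; apply/rowP => i; rewrite !mxE dual_funD.
- by move=> a x; apply/rowP => i; rewrite !mxE dual_funZ.
Qed.

Lemma dual_cyclic_minimal (P : dual A -> Prop) : (exists f, P f) ->
  exists2 f, P f & forall c, P (c *: f) -> exists d, f = d *: (c *: f).
Proof.
have [n [b [v bv]]] := dual_basis_exists A_fd.
apply: (@cyclic_minimal (dual A) n (fun f => \row_i dual_fun f (b i))) => //.
- move=> f g /rowP eq_fg; apply: (dual_basis_ext bv) => i.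
  by have := eq_fg i; rewrite !mxE.
- by move=> f g; apply/rowP => i; rewrite !mxE.
- move=> a f; apply/rowP => i.
  by rewrite !mxE dual_lscaleE mulrC dual_funZ.
Qed.

(** A power [y] of [x] generating an ideal of least dimension satisfies [y = d * (y * y)], and
    [d * y] is the idempotent. The positive exponent makes it a multiple of [x]. *)
Lemma fitting_idempotent (x : C) :
  exists j d, let e := d * x ^+ j.+1 in e * e = e /\ e * x ^+ j.+1 = x ^+ j.+1.
Proof.
have [] := @ring_cyclic_minimal (fun y => exists j, y = x ^+ j.+1).
  by exists x, 0%N.
move=> _ [j ->] min_x; have [|d xj] := min_x (x ^+ j.+1).
  by exists (j + j.+1)%N; rewrite -addSn exprD.
have ex : d * x ^+ j.+1 * x ^+ j.+1 = x ^+ j.+1 by rewrite -mulrA -xj.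
by exists j, d => /=; split; rewrite // mulrCA ex.
Qed.

Lemma dual_cyclicP (f g : dual A) :
    (forall x, (forall c, dual_fun f (c * x) = 0) -> dual_fun g x = 0) ->
  exists c, g = c *: f.
Proof.
(* Double annihilator: C f is the row space of the Gram matrix of f. *)
move=> perp; have [n [b [v bv]]] := dual_basis_exists A_fd.
pose G := \matrix_(i, j) dual_fun f (b i * b j).
have /submxP[D gD] : (\row_j dual_fun g (b j) <= G)%MS.
  rewrite submxE; apply/eqP/rowP => l.
  move: (cokermx G) (mulmx_coker G) => K GK.
  (* A column of the cokernel gives an [x] with [f] zero on [C x], so [perp] yields [g x = 0]. *)
  pose x := \sum_j A (K j l) * b j.
  have fb i : dual_fun f (b i * x) = 0.
    have /matrixP/(_ i l) := GK; rewrite !mxE => <-.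
    rewrite mulr_sumr dual_fun_sum; apply: eq_bigr => j _.
    by rewrite mxE mulrCA dual_funZ mulrC.
  rewrite [RHS]mxE -(perp x) => [|c]; last first.
    rewrite (bv.1 c) mulr_suml dual_fun_sum big1 // => i _.
    by rewrite -mulrA dual_funZ fb mulr0.
  rewrite mxE dual_fun_sum; apply: eq_bigr => j _.
  by rewrite mxE dual_funZ mulrC.
exists (\sum_i A (D 0 i) * b i); apply: (dual_basis_ext bv) => j.
have /rowP/(_ j) := gD; rewrite !mxE => ->.
rewrite dual_lscaleE mulr_sumr dual_fun_sum; apply: eq_bigr => i _.
by rewrite mulrCA dual_funZ mxE [b j * _]mulrC.
Qed.
End CommutativeAlgebra.

(** * Functionals on finitely generated modules *)

Section Functionals.
Variables (k : fieldType) (C : comPzRingType) (A : algebra k C).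
Hypothesis A_fd : finite_dimensional A.

(** Finite generation over [C] makes [V] a quotient of a row space over [k]; some coordinate on that
    quotient is nonzero at [u0]. *)
Lemma functional_separates (V : lmodType C) m (w : 'I_m -> V) (u0 : V) :
    (forall u, exists c : 'I_m -> C, u = \sum_i c i *: w i) -> u0 != 0 ->
  exists nu : V -> k,
    [/\ {morph nu : x y / x + y}, forall a x, nu (A a *: x) = a * nu x
       & nu u0 != 0].
Proof.
move=> spanw u0_neq0; have [n [b [v bv]]] := dual_basis_exists A_fd.
pose I : finType := ('I_m * 'I_n)%type.
pose phi (x : 'rV[k]_#|I|) :=
  \sum_(p : I) A (x 0 (enum_rank p)) *: (b p.2 *: w p.1).
have phiP a x y : phi (a *: x + y) = A a *: phi x + phi y.
  rewrite scaler_sumr -big_split; apply: eq_bigr => p _ /=.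
  by rewrite !mxE rmorphD rmorphM scalerDl -scalerA.
have phi0 : phi 0 = 0.
  by apply: big1 => p _; rewrite mxE rmorph0 scale0r.
have phi_surj u : exists x, phi x = u.
  have [c ->] := spanw u.
  exists (\row_l dual_fun (v (enum_val l).2) (c (enum_val l).1)).
  rewrite (eq_bigr (fun i => \sum_j A (dual_fun (v j) (c i)) *: (b j *: w i))).
    by rewrite pair_big; apply: eq_bigr => p _; rewrite mxE enum_rankK.
  move=> i _; rewrite {1}(bv.1 (c i)) scaler_suml.
  by apply: eq_bigr => j _; rewrite scalerA.
have [||M MP] := @subspace_submx k _ (fun x => phi x = 0) => //.
  by move=> a x y x0 y0; rewrite phiP x0 y0 scaler0 addr0.
(* The section [s] is merely a function; multiplying by [K] kills the kernel of [phi] and makes it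
   linear. *)
have /choice[s sK] := phi_surj.
pose K := cokermx M.
have sP a x y : s (A a *: x + y) *m K = (a *: s x + s y) *m K.
  apply/eqP; rewrite -subr_eq0 -mulmxBl -submxE; apply/MP.
  by rewrite addrC -scaleN1r phiP phiP !sK rmorphN rmorph1 scaleN1r addNr.
have /rV0Pn[j nz_j] : s u0 *m K != 0.
  by rewrite -submxE; apply: contra u0_neq0 => /MP; rewrite sK => ->.
have nuP a x y :
    (s (A a *: x + y) *m K) 0 j = a * (s x *m K) 0 j + (s y *m K) 0 j.
  by rewrite sP mulmxDl -scalemxAl !mxE.
have s0 : (s 0 *m K) 0 j = 0.
  have := nuP (-1) 0 0; rewrite rmorphN rmorph1 !scaleN1r oppr0 addr0.
  by rewrite mulN1r addNr.
exists (fun x => (s x *m K) 0 j); split=> // [x y|a x].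
  by have := nuP 1 x y; rewrite rmorph1 scale1r mul1r.
by have := nuP a x 0; rewrite s0 !addr0.
Qed.

End Functionals.

(** * Embedding the dual over one field into the dual over the other *)

Section TwoFields.
Variables (C : comPzRingType) (k1 k2 : fieldType).
Variables (A1 : algebra k1 C) (A2 : algebra k2 C).
Hypotheses (A1_fd : finite_dimensional A1) (A2_fd : finite_dimensional A2).

(** The field [k2] acts on [dual A1] through [C]. The last clause says that the kernel of [mu]
    contains no nonzero [C]-submodule of [e E_1], whose elements are the [f] fixed by [e]. *)
Definition separating (mu : dual A1 -> k2) (e : C) : Prop :=
  [/\ {morph mu : f g / f + g}, forall a f, mu (A2 a *: f) = a * mu f
     & forall f, e *: f = f -> (forall c, mu (c *: f) = 0) -> f = 0].

Lemma dual_functional (f0 : dual A1) : f0 != 0 ->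
  exists nu : dual A1 -> k2,
    [/\ {morph nu : f g / f + g}, forall a f, nu (A2 a *: f) = a * nu f
       & nu f0 != 0].
Proof.
have [n [b [v bv]]] := dual_basis_exists A1_fd.
apply: (functional_separates A2_fd (w := v)) => f.
by exists (fun i => A1 (dual_fun f (b i))); apply: dual_basis_expand.
Qed.

(** Any functional [nu] nonzero at a generator [f0] of a simple submodule works, because every
    nonzero submodule of [e E_1] contains [f0]. *)
Lemma separating_primitive (e : C) : e * e = e ->
  (forall e', e' * e' = e' -> e' * e = e' -> e' = 0 \/ e' = e) ->
  exists mu, separating mu e.
Proof.
move=> ee e_prim.
(* If [e E_1] is zero, the zero functional separates. *)
have [[f1 [ef1 nz_f1]]|no_f] :=
  pselect (exists f : dual A1, e *: f = f /\ f != 0); last first.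
  exists (fun=> 0); split=> [f g|a f|f ef _]; rewrite ?addr0 ?mulr0 //.
  by apply: contrapT => /eqP nz_f; apply: no_f; exists f.
have [|f0 [ef0 nz_f0] min_f0] :=
  @dual_cyclic_minimal _ _ A1 A1_fd (fun f => e *: f = f /\ f != 0).
  by exists f1.
(* Minimality of f0 means that it is killed by the nilpotents of C e. *)
have kill x j : x ^+ j * e = 0 -> x *: f0 = 0.
  move=> xje; apply: contrapT => /eqP nz_xf.
  have [|d f0d] := min_f0 x.
    by split=> //; rewrite scalerA mulrC -scalerA ef0.
  have f0j i : f0 = (d * x) ^+ i *: f0.
    elim: i => [|i IHi]; first by rewrite expr0 scale1r.
    by rewrite exprSr -scalerA -(scalerA d) -f0d.
  move: nz_f0; rewrite (f0j j) -ef0 scalerA exprMn -mulrA xje mulr0 scale0r.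
  by rewrite eqxx.
have socle g : e *: g = g -> g != 0 -> exists c, f0 = c *: g.
  move=> eg nz_g; apply: dual_cyclicP => // x gx.
  (* By primitivity [i * e] is [0] or [e]. In the first case [x] is nilpotent on [C e], so it kills
     [f0]; in the second [e] is a multiple of [x], so [g], which vanishes on [C x], would be
     zero. *)
  have [j [d [ii ix]]] := fitting_idempotent A1_fd x.
  set i := d * x ^+ j.+1 in ii ix.
  have [||ie|ie] := e_prim (i * e).
  - by rewrite mulrACA ii ee.
  - by rewrite -mulrA ee.
  - have : x *: f0 = 0 by apply: (@kill x j.+1); rewrite -ix mulrAC ie mul0r.
    by move/(congr1 (fun f => dual_fun f 1)); rewrite dual_lscaleE mul1r.
  - case/eqP: nz_g; apply: dual_ext => c.
    rewrite -eg dual_lscaleE -ie /i exprSr.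
    by rewrite (_ : _ * _ = c * d * x ^+ j * e * x) ?gx //; ring.
have [nu [nuD nuZ nu_f0]] := dual_functional nz_f0.
exists nu; split=> // f ef nu_f; apply: contrapT => /eqP nz_f.
have [c f0c] := socle f ef nz_f.
by move: nu_f0; rewrite f0c nu_f eqxx.
Qed.

(** A counterexample [e] with [C e] minimal is not primitive, so it splits as [e1 + (e - e1)].
    Separating functionals for the two pieces add up to one for [e]. *)
Lemma separating_idempotent (e : C) : e * e = e -> exists mu, separating mu e.
Proof.
move=> ee; apply: contrapT => no_e.
pose P x := x * x = x /\ ~ exists mu, separating mu x.
have [|{no_e ee}e [ee no_e] min_e] := ring_cyclic_minimal A1_fd (P := P).
  by exists e.
(* A counterexample [e'] below [e] would generate the same ideal by minimality, and two idempotents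
   generating the same ideal are equal. *)
have sub e' :
    e' * e' = e' -> e' * e = e' -> e' <> e -> exists mu, separating mu e'.
  move=> e'e' e'e ne_e'e; apply: contrapT => no_e'.
  case: ne_e'e; have [|d ed] := min_e e'; first by rewrite e'e.
  by rewrite -{1}e'e {1 2}ed e'e mulrCA e'e'.
apply: no_e; have [|] := pselect (forall e1, e1 * e1 = e1 -> e1 * e = e1 ->
                                    e1 = 0 \/ e1 = e).
  exact: separating_primitive.
move=> /existsNP[e1 /not_implyP[e1e1 /not_implyP[e1e /not_orP[ne1_0 ne1_e]]]].
have [mu1 [D1 Z1 S1]] := sub e1 e1e1 e1e ne1_e.
have [|||mu2 [D2 Z2 S2]] := sub (e - e1).
- by rewrite mulrBr !mulrBl ee e1e1 e1e [e * e1]mulrC e1e subrr subr0.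
- by rewrite mulrBl ee e1e.
- by move/eqP; rewrite -subr_eq0 addrAC subrr add0r oppr_eq0 => /eqP.
exists (fun f => mu1 (e1 *: f) + mu2 ((e - e1) *: f)); split.
- by move=> f g; rewrite !scalerDr D1 D2 addrACA.
- move=> a f; rewrite mulrDr -Z1 -Z2 !scalerA.
  by rewrite ![_ * A2 a]mulrC.
move=> f ef mu_f.
have -> : f = (e - e1) *: f + e1 *: f by rewrite -scalerDl subrK ef.
have e2e1 : (e - e1) * e1 = 0 by rewrite mulrBl e1e1 [e * e1]mulrC e1e subrr.
have e2e2 : (e - e1) * (e - e1) = e - e1.
  by rewrite mulrBr e2e1 subr0 mulrBl ee e1e.
have mu1_0 : mu1 0 = 0 by apply: (addIr (mu1 0)); rewrite -D1 !add0r.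
have mu2_0 : mu2 0 = 0 by apply: (addIr (mu2 0)); rewrite -D2 !add0r.
have -> : e1 *: f = 0.
  apply: S1 => [|c]; first by rewrite scalerA e1e1.
  (* Testing on multiples of [e1] removes the second summand, since [(e - e1) * e1 = 0]. *)
  have := mu_f (c * e1).
  by rewrite !scalerA mulrCA e1e1 mulrCA e2e1 mulr0 scale0r mu2_0 addr0.
have -> : (e - e1) *: f = 0.
  apply: S2 => [|c]; first by rewrite scalerA e2e2.
  have := mu_f (c * (e - e1)).
  rewrite !scalerA [e1 * _]mulrCA [e1 * _]mulrC e2e1 mulr0 scale0r mu1_0 add0r.
  by rewrite mulrCA e2e2.
by rewrite addr0.
Qed.

(** Take [mu] separating for the idempotent [1] and send [f] to the functional [mu (c *: f)] of [c].
    If this vanishes for all [c], then [C f] lies in the kernel of [mu], so [f = 0]. *)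
Lemma dual_embedding :
  exists phi : {linear dual A1 -> dual A2}, injective phi.
Proof.
have [mu [muD muZ mu_inj]] := separating_idempotent (mulr1 1).
have phiD f : {morph (fun c => mu (c *: f)) : x y / x + y}.
  by move=> x y; rewrite scalerDl muD.
have phiZ f a c : mu ((A2 a * c) *: f) = a * mu (c *: f).
  by rewrite -scalerA muZ.
pose phi (f : dual A1) : dual A2 := mk_dual (phiD f) (phiZ f).
have phi_lin : linear phi.
  move=> d f g; apply: dual_ext => c.
  by rewrite mk_dualE scalerDr muD scalerA.
exists (HB.pack_for {linear dual A1 -> dual A2} phi
  (GRing.isLinear.Build C (dual A1) (dual A2) *:%R phi phi_lin)).
move=> f g eq_fg; apply/eqP; rewrite -subr_eq0; apply/eqP/mu_inj => [|c].
  by rewrite scale1r.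
have mu0 : mu 0 = 0 by apply: (addIr (mu 0)); rewrite -muD !add0r.
have muN h : mu (- h) = - mu h.
  by apply: (addIr (mu h)); rewrite -muD !addNr.
have := congr1 (fun h => dual_fun h c) eq_fg; rewrite !mk_dualE => eq_mu.
by rewrite scalerBr muD muN eq_mu subrr.
Qed.

End TwoFields.

(** * Isomorphism of the duals in the commutative case *)

Section LinearEndomorphisms.
Variables (k : fieldType) (C : comPzRingType) (A : algebra k C).

(** A [C]-linear [h] is [k]-linear, hence given by a square matrix [T]; injectivity makes [T]
    invertible. *)
Lemma dual_inj_surj (h : {linear dual A -> dual A}) :
  finite_dimensional A -> injective h -> forall g, exists f, h f = g.
Proof.
move=> /dual_basis_exists[n [b [v bv]]] h_inj g.
pose row_of (f : dual A) := \row_j dual_fun f (b j).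
have row_inj : injective row_of.
  move=> f f' /rowP eq_ff'; apply: (dual_basis_ext bv) => i.
  by have := eq_ff' i; rewrite !mxE.
have scale_funE a (f : dual A) x : dual_fun (A a *: f) x = a * dual_fun f x.
  by rewrite dual_lscaleE mulrC dual_funZ.
pose of_row (u : 'rV_n) : dual A := \sum_i A (u 0 i) *: v i.
have of_rowK u : row_of (of_row u) = u.
  apply/rowP => j; rewrite mxE dual_funE_sum (bigD1 j) // big1.
    by rewrite scale_funE bv.2 eqxx mulr1 /= addr0.
  by move=> i ne_ij; rewrite scale_funE bv.2 (negPf ne_ij) mulr0.
pose T := \matrix_i row_of (h (v i)).
have row_h f : row_of (h f) = row_of f *m T.
  apply/rowP => j; rewrite {1}(dual_basis_expand bv f) linear_sum !mxE.
  rewrite dual_funE_sum; apply: eq_bigr => i _.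
  by rewrite linearZ scale_funE !mxE.
have T_unit : T \in unitmx.
  rewrite -row_free_unit; apply/inj_row_free => u uT.
  have /h_inj u0 : h (of_row u) = h 0.
    apply: row_inj; rewrite row_h of_rowK uT linear0.
    by apply/rowP => j; rewrite !mxE.
  by rewrite -(of_rowK u) u0; apply/rowP => j; rewrite !mxE.
exists (of_row (row_of g *m invmx T)); apply: row_inj.
by rewrite row_h of_rowK mulmxKV.
Qed.

End LinearEndomorphisms.

Lemma commutative_dual_iso (C : comPzRingType) (k1 k2 : fieldType)
    (A1 : algebra k1 C) (A2 : algebra k2 C) :
  finite_dimensional A1 -> finite_dimensional A2 ->
  lmod_iso (dual A1) (dual A2).
Proof.
move=> fd1 fd2; have [phi phi_inj] := dual_embedding fd1 fd2.
have [psi psi_inj] := dual_embedding fd2 fd1.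
exists phi; apply: inj_surj_bijective => // g.
(* Surjectivity of the composite gives [psi (phi f) = psi g], and [psi] cancels. *)
have [f psi_f] := dual_inj_surj (h := psi \o phi) fd1 (inj_comp psi_inj phi_inj)
  (psi g).
by exists f; apply: psi_inj.
Qed.

(** * The center as a commutative algebra over each field *)

Section Center.
Variable R : pzRingType.

Definition central : pred R := fun c => `[< forall x, GRing.comm c x >].

Fact central_subring : subring_closed central.
Proof.
split=> [|c d /asboolP cC /asboolP dC|c d /asboolP cC /asboolP dC];
  apply/asboolP => x.
- exact/commr_sym/commr1.
- by apply/commr_sym/commrB; apply/commr_sym.
- by apply/commr_sym/commrM; apply/commr_sym.
Qed.

Definition center := {c : R | central c}.
HB.instance Definition _ := SubType.on center.
HB.instance Definition _ := Choice.on center.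
HB.instance Definition _ :=
  GRing.SubChoice_isSubPzRing.Build R central center central_subring.
Fact center_mulC : commutative (@GRing.mul center).
Proof.
move=> c d; apply: val_inj; have /asboolP cC := valP c.
by rewrite !rmorphM; apply: cC.
Qed.
HB.instance Definition _ :=
  GRing.PzRing_hasCommutativeMul.Build center center_mulC.

End Center.

Section CenterAlgebra.
Variables (k : fieldType) (R : pzRingType) (A : algebra k R).

Definition center_map (a : k) : center R :=
  exist _ (A a) (asboolT (alg_central A a)).

Fact center_map_zmod_morphism : zmod_morphism center_map.
Proof. by move=> a b; apply: val_inj; rewrite /= rmorphB. Qed.
Fact center_map_monoid_morphism : monoid_morphism center_map.
Proof.
by split=> [|a b]; apply: val_inj; rewrite /= (rmorph1, rmorphM).
Qed.
HB.instance Definition _ := GRing.isZmodMorphism.Build k (center R) center_map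
  center_map_zmod_morphism.
HB.instance Definition _ := GRing.isMonoidMorphism.Build k (center R) center_map
  center_map_monoid_morphism.

Definition center_algebra : algebra k (center R) :=
  @Algebra k (center R) center_map (fun a x => mulrC _ _).

Lemma center_finite_dimensional :
  finite_dimensional A -> finite_dimensional center_algebra.
Proof.
case=> n [[v v_lin v_bij]].
pose g (c : underlying center_algebra) : 'rV[k]_n :=
  v (val (c : center R) : underlying A).
have g_lin : linear g by move=> a c d; apply: v_lin.
pose G : {linear underlying center_algebra -> 'rV[k]_n} :=
  HB.pack_for {linear underlying center_algebra -> 'rV[k]_n} g
    (GRing.isLinear.Build k (underlying center_algebra) 'rV[k]_n *:%R g g_lin).
apply: (@finite_dimensional_inj _ _ _ n G) => c d /(bij_inj v_bij).
exact: val_inj.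
Qed.

Lemma center_slice_exists (f : dual A) (r : R) :
  {h : dual center_algebra | forall c, dual_fun h c = dual_fun f (val c * r)}.
Proof.
have hD : {morph (fun c : center R => dual_fun f (val c * r)) : c d / c + d}.
  by move=> c d; rewrite rmorphD mulrDl dual_funD.
have hZ a (c : center R) :
    dual_fun f (val (center_algebra a * c) * r) = a * dual_fun f (val c * r).
  by rewrite rmorphM -mulrA dual_funZ.
by exists (mk_dual hD hZ).
Qed.

(* The image of f in Hom_C(R, Hom_k(C, k)), evaluated at r. *)
Definition center_slice (f : dual A) (r : R) : dual center_algebra :=
  sval (center_slice_exists f r).

Lemma center_sliceE f r c :
  dual_fun (center_slice f r) c = dual_fun f (val c * r).
Proof. exact: (svalP (center_slice_exists f r)). Qed.

End CenterAlgebra.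

(** * Transport of functionals from the center to the whole ring *)

Section Transport.
Variables (R : pzRingType) (k1 k2 : fieldType).
Variables (A1 : algebra k1 R) (A2 : algebra k2 R).

(** Composition with [phi] maps Hom_C(R, E_1) to Hom_C(R, E_2), and evaluation at [1] recovers a
    functional on [R] from the result. *)
Lemma dual_transport_exists
    (phi : {linear dual (center_algebra A1) -> dual (center_algebra A2)})
    (f : dual A1) :
  {g : dual A2 | forall r, center_slice g r = phi (center_slice f r)}.
Proof.
have sliceZ (c : center R) r :
    center_slice f (val c * r) = c *: center_slice f r.
  by apply: dual_ext => d; rewrite dual_lscaleE !center_sliceE rmorphM mulrA.
pose g r := dual_fun (phi (center_slice f r)) 1.
have gD : {morph g : r s / r + s}.
  move=> r s; rewrite /g -dual_addE -linearD; congr (dual_fun (phi _) 1).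
  by apply: dual_ext => d; rewrite dual_addE !center_sliceE mulrDr dual_funD.
have gZ a r : g (A2 a * r) = a * g r.
  (* Scalars of [k2] pass through the [C]-linear [phi] because [A2 a] lies in the center. *)
  rewrite /g -[A2 a]/(val (center_algebra A2 a)) sliceZ linearZ dual_lscaleE.
  by rewrite mul1r -[X in dual_fun _ X]mulr1 dual_funZ.
exists (mk_dual gD gZ) => r; apply: dual_ext => c.
by rewrite center_sliceE mk_dualE /g sliceZ linearZ dual_lscaleE mul1r.
Qed.

Definition dual_transport phi (f : dual A1) : dual A2 :=
  sval (dual_transport_exists phi f).

Lemma center_slice_transport phi f r :
  center_slice (dual_transport phi f) r = phi (center_slice f r).
Proof. exact: (svalP (dual_transport_exists phi f)). Qed.

Lemma dual_transportE phi f r :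
  dual_fun (dual_transport phi f) r = dual_fun (phi (center_slice f r)) 1.
Proof. by rewrite -center_slice_transport center_sliceE mul1r. Qed.

End Transport.

Lemma center_slice_inj (R : pzRingType) (k : fieldType) (A : algebra k R)
    (f g : dual A) : (forall r, center_slice f r = center_slice g r) -> f = g.
Proof.
move=> eq_fg; apply: dual_ext => r.
by rewrite -[r]mul1r -[1]/(val (1 : center R)) -!center_sliceE eq_fg.
Qed.

(** Transport along the inverse of [phi] inverts transport along [phi]. Both actions of [R] only
    change the argument of a slice, which [phi] does not see. *)
Lemma dual_bimod_iso (R : pzRingType) (k1 k2 : fieldType)
    (A1 : algebra k1 R) (A2 : algebra k2 R) :
  finite_dimensional A1 -> finite_dimensional A2 ->
  bimod_iso (dual A1) (dual A2).
Proof.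
move=> /center_finite_dimensional fd1 /center_finite_dimensional fd2.
have [phi [psi0 psi0K phiK]] := commutative_dual_iso fd1 fd2.
have psi_lin : linear psi0.
  by move=> c f g; apply: (can_inj psi0K); rewrite linearP !phiK.
pose psi : {linear dual (center_algebra A2) -> dual (center_algebra A1)} :=
  HB.pack_for {linear dual (center_algebra A2) -> dual (center_algebra A1)} psi0
    (GRing.isLinear.Build (center R) (dual (center_algebra A2))
       (dual (center_algebra A1)) *:%R psi0 psi_lin).
pose F := @dual_transport R k1 k2 A1 A2 phi.
have F_lin : linear F.
  move=> r f g; apply: dual_ext => s.
  rewrite dual_addE dual_lscaleE !dual_transportE -dual_addE -linearD.
  congr (dual_fun (phi _) 1); apply: dual_ext => c.
  by rewrite dual_addE !center_sliceE dual_addE dual_lscaleE mulrA.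
exists (HB.pack_for {linear dual A1 -> dual A2} F
  (GRing.isLinear.Build R (dual A1) (dual A2) *:%R F F_lin)).
split=> [|f s].
  exists (@dual_transport R k2 k1 A2 A1 psi) => f; apply: center_slice_inj => r.
    by rewrite !center_slice_transport; apply: psi0K.
  by rewrite !center_slice_transport; apply: phiK.
apply: dual_ext => r; rewrite dual_rscaleE.
rewrite -[LHS]/(dual_fun (F (rscale f s)) r) -[RHS]/(dual_fun (F f) (s * r)).
rewrite !dual_transportE; congr (dual_fun (phi _) 1); apply: dual_ext => c.
rewrite !center_sliceE dual_rscaleE mulrA.
(* Right linearity requires [s] to move past [c], which is central. *)
by have /asboolP cC := valP c; rewrite -(cC s) mulrA.
Qed.

Theorem corollary3 (R : pzRingType) (k1 k2 : fieldType)
    (A1 : algebra k1 R) (A2 : algebra k2 R) :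
  finite_dimensional A1 -> finite_dimensional A2 -> frobenius A1 ->
  bimod_iso (dual A1) (dual A2).
Proof. by move=> fd1 fd2 _; apply: dual_bimod_iso. Qed.
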